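(* Let $H$ be a complex Hilbert space, let $A,B\in B^{++}(H)$, let $n\in\mathbb{N}$ with $n\ge2$, and let $v\in\mathbb{R}$ with $v\neq\frac12$. (i) If $v\notin\left[\frac12,\frac{2^{n-1}+1}{2^n}\right]$, then $$A\nabla B\le \hat H_v(A,B)+2(1-v)\left(A\nabla B-A\sharp B\right)+(2v-1)\sum_{k=2}^n2^{k-2}\left(A\sharp B-2H_{\frac{2^{k-1}+1}{2^k}}(A,B)+H_{\frac{2^{k-2}+1}{2^{k-1}}}(A,B)\right).$$ (ii) If $v\notin\left[\frac{2^{n-1}-1}{2^n},\frac12\right]$, then $$A\nabla B\le \hat H_v(A,B)+2v\left(A\nabla B-A\sharp B\right)+(1-2v)\sum_{k=2}^n2^{k-2}\left(A\sharp B-2H_{\frac{2^{k-1}-1}{2^k}}(A,B)+H_{\frac{2^{k-2}-1}{2^{k-1}}}(A,B)\right).$$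
   Context: $B(H)$ is the algebra of bounded linear operators on the complex Hilbert space $H$. A self-adjoint $T\in B(H)$ is positive, written $T\ge0$, if $\langle Tx,x\rangle\ge0$ for all $x\in H$; $S\le T$ means $T-S\ge0$. $B^{++}(H)$ is the set of positive invertible operators in $B(H)$. For $A,B\in B^{++}(H)$ and $v\in\mathbb{R}$, set $A\natural_v B=A^{1/2}\left(A^{-1/2}BA^{-1/2}\right)^vA^{1/2}$ (real powers via continuous functional calculus) and $\hat H_v(A,B)=\frac{A\natural_v B+A\natural_{1-v}B}{2}$. For $v\in[0,1]$ one writes $A\sharp_v B=A\natural_v B$ and $H_v(A,B)=\frac{A\sharp_v B+A\sharp_{1-v}B}{2}$. Further, $A\nabla B=\frac{A+B}2$ and $A\sharp B=A\sharp_{1/2}B$. *)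

(* Defs.v *)
From HB Require Import structures.
From mathcomp Require Import all_boot all_order all_algebra.
From mathcomp Require Import sesquilinear complex.
From mathcomp Require Import all_classical all_reals all_analysis.
Import Order.TTheory GRing.Theory Num.Theory.
Import numFieldNormedType.Exports.

Set Implicit Arguments.
Unset Strict Implicit.
Unset Printing Implicit Defensive.

Local Open Scope classical_set_scope.
Local Open Scope complex_scope.
Local Open Scope ring_scope.

(* The inner product is linear in its first argument and conjugate-linear in
   the second. *)
HB.mixin Record CompleteNormedModule_isHilbert (R : realType) (H : Type)
    of CompleteNormedModule R[i] H := {
  inner : {dot H for (@Num.conj R[i])} ;
  inner_normE : forall x : H, `|x| ^+ 2 = inner x x
}.

#[short(type="hilbertType")]
HB.structure Definition Hilbert (R : realType) :=
  {H of CompleteNormedModule R[i] H & CompleteNormedModule_isHilbert R H}.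

Section operators.
Context {R : realType} {H : hilbertType R}.
Implicit Types (S T A B : H -> H) (v : R).

Definition bounded_op T : Prop :=
  linear T /\ exists M : R, forall x, `|T x| <= M%:C * `|x|.

Definition self_adjoint T : Prop :=
  bounded_op T /\ forall x y, inner (T x) y = inner x (T y).

(* On R[i], [0 <= z] means that z is real and nonnegative. *)
Definition positive_op T : Prop :=
  self_adjoint T /\ forall x, 0 <= inner (T x) x.

Definition loewner_le S T : Prop := positive_op (T - S).

Definition invertible_op T : Prop :=
  bounded_op T /\
  exists S, [/\ bounded_op S, cancel S T & cancel T S].

Definition positive_invertible T : Prop := positive_op T /\ invertible_op T.

Definition spectrum T : set R[i] :=
  [set z | ~ invertible_op (fun x => T x - z *: x)].

Definition poly_op (p : {poly R}) T : H -> H :=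
  fun x => \sum_(i < size p) (p`_i)%:C *: iter i T x.

(* For T self-adjoint and f continuous on the spectrum of T (which is then a
   compact subset of the real line), f(T) is the limit in operator norm of
   p(T) for real polynomials p converging to f uniformly on the spectrum.
   [is_fun_calc f T S] says that S is such a limit; the limit exists
   (Weierstrass) and does not depend on the polynomials, since
   ||p(T)|| = sup {|p(t)| : t in the spectrum of T}. *)
Definition is_fun_calc (f : R -> R) T S : Prop :=
  forall e : R, 0 < e -> exists p : {poly R},
    (forall t : R, spectrum T t%:C -> `|p.[t] - f t| <= e) /\
    (forall x, `|poly_op p T x - S x| <= e%:C * `|x|).

Definition fun_calc (f : R -> R) T : H -> H :=
  xget (0 : H -> H) [set S | is_fun_calc f T S].

(* Used for T positive and invertible only, whose spectrum lies in ]0, +oo[. *)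
Definition op_powR T v : H -> H := fun_calc (fun t => t `^ v) T.

Definition nat_mean v A B : H -> H :=
  op_powR A 2^-1 \o
  op_powR (op_powR A (- 2^-1) \o B \o op_powR A (- 2^-1)) v \o
  op_powR A 2^-1.

(* For v in [0, 1] this is the Heinz mean H_v(A, B), otherwise its extension
   \hat H_v(A, B); both are given by the same formula. *)
Definition heinz_mean v A B : H -> H :=
  2^-1 *: (nat_mean v A B + nat_mean (1 - v) A B).

Definition geom_mean A B : H -> H := nat_mean 2^-1 A B.

Definition arith_mean A B : H -> H := 2^-1 *: (A + B).

End operators.

(* Main.v *)
Require Import Defs.
From HB Require Import structures.
From mathcomp Require Import all_boot all_order all_algebra.
From mathcomp Require Import sesquilinear complex ring lra.
From mathcomp Require Import all_classical all_reals all_analysis.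
Import Order.TTheory GRing.Theory Num.Theory.
Import numFieldNormedType.Exports.
Local Open Scope complex_scope.
Local Open Scope ring_scope.

(** The Heinz mean depends on its parameter w through operator powers, so the
whole statement is a convexity inequality for scalars pushed through the
functional calculus.

Write G for the geometric mean, M for the arithmetic mean, and H(w) for the
Heinz mean at w; then G = H(1/2) and M = H(1). With
w_k = 1/2 + 2^(-k) the sum over k telescopes to
(M - G) - 2^(n-1) (H(w_n) - G), and the right-hand side minus the left-hand side
of the first inequality becomes
H(v) - H(1/2) - (v - 1/2) / (w_n - 1/2) * (H(w_n) - H(1/2))
([heinz_mean_telescope]). So the claim is that H(v) lies above the secant of H
through 1/2 and w_n whenever v lies outside the interval from 1/2 to w_n. The second
inequality is the first one at 1 - v, since H(w) = H(1 - w).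

To reduce to scalars, put P = A^(1/2), Q = A^(-1/2) and C = Q B Q. Then P P = A
and P, Q are inverse to each other, whence H(w) = P h_w(C) P with
h_w(t) = (t^w + t^(1-w)) / 2, and H(1) = M. The difference above is P F(C) P with
F nonnegative on ]0, +oo[ because w |-> t^w is convex ([heinz_secant]), and
F(C) is positive because the functional calculus preserves positivity.

The functional calculus itself rests on one fact ([poly_op_ge0]): if T is
self-adjoint and the real polynomial q is nonnegative on the real spectrum of T,
then q(T) >= 0. Let m be the largest real with m <= q(T). The operator
q(T) - m is positive but not coercive, hence not invertible
([positive_coercive]); factoring q - m over the complex numbers, some root of it
lies in the spectrum. That root is real, since T - z is invertible for z not
real ([self_adjoint_spectrum_real]), so m is a value of q on the spectrum and
m >= 0. Invertibility is always obtained from coercivity and a Neumann series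
([coercive_invertible]). Applied to e^2 - q^2 the fact bounds the norm of q(T), which
gives existence (by completeness) and uniqueness of f(T).
Existence for powers also takes a Weierstrass theorem; Lipschitz functions
suffice, and their Bernstein polynomials converge uniformly
([weierstrass_lipschitz]). *)

Set Implicit Arguments.
Unset Strict Implicit.
Unset Printing Implicit Defensive.

(** * Uniform polynomial approximation and scalar convexity *)

Section scalar.
Context {R : realType}.

(** The polynomial whose value at x is the expectation of phi of a binomial
    variable with n trials and success probability x, that is, the sum of
    'C(n, k) x^k (1 - x)^(n - k) phi(k). Conditioning on the first trial gives
    the recursion, which makes positivity and the second moment below immediate
    inductions. *)
Fixpoint bernstein (n : nat) (phi : nat -> R) : {poly R} :=
  if n is m.+1 then 'X * bernstein m (phi \o S) + (1 - 'X) * bernstein m phi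
  else (phi 0%N)%:P.

Lemma bernsteinS n phi x : (bernstein n.+1 phi).[x] =
  x * (bernstein n (phi \o S)).[x] + (1 - x) * (bernstein n phi).[x].
Proof. by rewrite /= !hornerE. Qed.

Lemma bernstein_le n phi psi x : 0 <= x <= 1 ->
  (forall k, (k <= n)%N -> phi k <= psi k) ->
  (bernstein n phi).[x] <= (bernstein n psi).[x].
Proof.
move=> /andP[x0 x1]; elim: n phi psi => [|n IH] phi psi h.
  by rewrite !hornerE h.
rewrite !bernsteinS lerD ?ler_wpM2l ?subr_ge0//; apply: IH => k kn; apply: h => //.
exact: leqW.
Qed.

(** The second moment about c is variance plus squared bias; centring at c = n x
    leaves the variance n x (1 - x). *)
Lemma bernstein_quad n x c a b :
  (bernstein n (fun k => a + b * (k%:R - c) ^+ 2)).[x] =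
  a + b * (n%:R * x * (1 - x) + (n%:R * x - c) ^+ 2).
Proof.
elim: n c => [|n IH] c; first by rewrite !hornerE; ring.
rewrite bernsteinS IH.
have -> : (fun k => a + b * (k%:R - c) ^+ 2) \o S =
          (fun k => a + b * (k%:R - (c - 1)) ^+ 2).
  by apply/funext => k /=; rewrite -natr1; ring.
by rewrite IH -natr1; ring.
Qed.

(** Once rescaled by n^2, the variance of the nodes is at most 1 / n, so a
    quadratic modulus of continuity with constant K costs K / n. *)
Lemma bernstein_approx n phi x y e K : (0 < n)%N -> 0 <= x <= 1 -> 0 <= K ->
  (forall k, (k <= n)%N -> `|phi k - y| <= e + K * (k%:R / n%:R - x) ^+ 2) ->
  `|(bernstein n phi).[x] - y| <= e + K / n%:R.
Proof.
move=> n0 x01 K0 h; have n0' : 0 < n%:R :> R by rewrite ltr0n.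
have nN : n%:R != 0 :> R by rewrite gt_eqF.
have E k : K * (k%:R / n%:R - x) ^+ 2 = K / n%:R ^+ 2 * (k%:R - n%:R * x) ^+ 2.
  by field.
have B : K / n%:R ^+ 2 * (n%:R * x * (1 - x)) <= K / n%:R.
  have -> : K / n%:R ^+ 2 * (n%:R * x * (1 - x)) = K / n%:R * (x * (1 - x)).
    by field.
  by rewrite ler_piMr ?divr_ge0 ?(ltW n0')//; case/andP: x01 => *; nra.
rewrite ler_norml; apply/andP; split.
- rewrite lerBrDr; apply: (le_trans _ (@bernstein_le n
    (fun k => (y - e) + (- (K / n%:R ^+ 2)) * (k%:R - n%:R * x) ^+ 2) phi x x01 _)).
    by rewrite bernstein_quad subrr expr0n addr0; lra.
  by move=> k /h; rewrite E ler_norml => /andP[]; lra.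
- rewrite lerBlDr; apply: (le_trans (@bernstein_le n phi
    (fun k => (y + e) + (K / n%:R ^+ 2) * (k%:R - n%:R * x) ^+ 2) x x01 _)).
    by move=> k /h; rewrite E ler_norml => /andP[]; lra.
  by rewrite bernstein_quad subrr expr0n addr0; lra.
Qed.

(** By the inequality of arithmetic and geometric means a Lipschitz modulus
    L |d| is at most e / 2 + (L d)^2 / (2 e), which is the quadratic modulus that
    Bernstein polynomials handle. *)
Lemma weierstrass_lipschitz (f : R -> R) (a b L : R) : a < b ->
  (forall s t, a <= s <= b -> a <= t <= b -> `|f s - f t| <= L * `|s - t|) ->
  forall e : R, 0 < e -> exists p : {poly R},
  forall t, a <= t <= b -> `|p.[t] - f t| <= e.
Proof.
move=> ab fL e e0.
have ba0 : 0 < b - a by rewrite subr_gt0.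
(* The factor b - a comes from rescaling to the unit interval. *)
pose K : R := (L * (b - a)) ^+ 2 / (2 * e).
have K0 : 0 <= K by rewrite divr_ge0 ?sqr_ge0// mulr_ge0// ltW.
have [n Kn] : exists n, K / n.+1%:R <= e / 2.
  exists (Num.bound (K / (e / 2))).
  have e2 : 0 < e / 2 by lra.
  rewrite ler_pdivrMr ?ltr0n//. rewrite [leRHS]mulrC -ler_pdivrMr// ltW//.
  apply: (lt_le_trans (archi_boundP (divr_ge0 K0 (ltW e2)))).
  by rewrite ler_nat.
pose N := n.+1.
pose q := bernstein N (fun k => f (a + (b - a) * (k%:R / N%:R))).
exists (q \Po ((b - a)^-1 *: ('X - a%:P))) => t tab.
rewrite horner_comp hornerZ hornerXsubC.
set x := (b - a)^-1 * (t - a).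
have tE : t = a + (b - a) * x by rewrite /x mulrA divff ?gt_eqF// mul1r addrC subrK.
have x01 : 0 <= x <= 1.
  case/andP: tab => ta tb; rewrite mulr_ge0 ?invr_ge0 ?(ltW ba0) ?subr_ge0//=.
  by rewrite /x mulrC ler_pdivrMr// mul1r lerD2r.
have -> : e = e / 2 + e / 2 by lra.
apply: (le_trans _ (lerD (lexx _) Kn)).
apply: bernstein_approx => // k kN.
have s01 : 0 <= (k%:R / N%:R : R) <= 1.
  by rewrite divr_ge0//= ler_pdivrMr ?ltr0n// mul1r ler_nat.
have sab : a <= a + (b - a) * (k%:R / N%:R) <= b by case/andP: s01 => *; nra.
apply: (le_trans (fL _ _ sab tab)); rewrite [in leLHS]tE.
have -> : a + (b - a) * (k%:R / N%:R) - (a + (b - a) * x) =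
          (b - a) * (k%:R / N%:R - x) by ring.
set d := _ - x; rewrite normrM (gtr0_norm ba0) mulrA.
have -> : K * d ^+ 2 = (L * (b - a) * `|d|) ^+ 2 / (2 * e).
  by rewrite exprMn real_normK ?num_real// /K mulrAC.
rewrite -subr_ge0.
have -> : e / 2 + (L * (b - a) * `|d|) ^+ 2 / (2 * e) - L * (b - a) * `|d| =
  (L * (b - a) * `|d| - e) ^+ 2 / (2 * e) by field; rewrite gt_eqF.
by rewrite divr_ge0 ?sqr_ge0// mulr_ge0// ltW.
Qed.

(** The power is monotone in s, but in a direction that depends on the sign of
    v; the sum of the endpoint values is a bound in both cases. *)
Lemma powR_le_endpoints (a b v s : R) : 0 < a -> a <= s <= b ->
  s `^ v <= a `^ v + b `^ v.
Proof.
move=> a0 /andP[as_ sb].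
have s0 : 0 < s by exact: lt_le_trans as_.
have b0 : 0 < b by exact: lt_le_trans sb.
have [v0|v0] := leP 0 v.
  apply: ler_wpDl; first exact: powR_ge0.
  by rewrite ge0_ler_powR// nnegrE ltW.
apply: ler_wpDr; first exact: powR_ge0.
by rewrite /powR !gt_eqF// ler_expR ler_wnM2l ?(ltW v0)// ler_ln// posrE.
Qed.

Lemma powR_lipschitz (a b v s t : R) : 0 < a -> a <= s <= b -> a <= t <= b ->
  `|s `^ v - t `^ v| <= ((a `^ v + b `^ v) * `|v| / a) * `|s - t|.
Proof.
move=> a0.
wlog : s t / t `^ v <= s `^ v => [H sab tab|].
  have [|/ltW] := leP (t `^ v) (s `^ v) => h; first exact: H.
  by rewrite distrC (distrC s); exact: H.
move=> ts /andP[as_ sb] /andP[at_ tb].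
have s0 : 0 < s by exact: lt_le_trans as_.
have t0 : 0 < t by exact: lt_le_trans at_.
have pE (x : R) : 0 < x -> x `^ v = expR (v * ln x).
  by move=> x0; rewrite /powR gt_eqF.
rewrite ger0_norm ?subr_ge0//.
have sB : s `^ v <= a `^ v + b `^ v by apply: powR_le_endpoints; rewrite ?as_.
have lnB (x y : R) : a <= x -> a <= y -> ln y - ln x <= `|x - y| / a.
  move=> ax ay; have x0 : 0 < x by exact: lt_le_trans ax.
  have y0 : 0 < y by exact: lt_le_trans ay.
  rewrite -ln_div ?posrE//.
  have -> : y / x = 1 + (y - x) / x by field; rewrite gt_eqF.
  apply: (@le_trans _ _ ((y - x) / x)).
    apply: le_ln1Dx.
    have -> : (y - x) / x = y / x - 1 by field; rewrite gt_eqF.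
    by rewrite ltrDr divr_gt0.
  rewrite distrC (le_trans (ler_norm _))// normrM ler_wpM2l//.
  by rewrite gtr0_norm ?invr_gt0// lef_pV2// posrE.
have lnN : `|ln t - ln s| <= `|s - t| / a.
  by rewrite ler_norml lnB// andbT lerNl opprB (distrC s) lnB.
have st : s `^ v - t `^ v <= s `^ v * (`|v| * `|ln t - ln s|).
  have -> : t `^ v = s `^ v * expR (v * (ln t - ln s)).
    by rewrite !pE// -expRD; congr expR; ring.
  rewrite -[X in X - _]mulr1 -mulrBr ler_wpM2l ?powR_ge0// -normrM -normrN.
  apply: (le_trans _ (ler_norm _)); have := expR_ge1Dx (v * (ln t - ln s)); lra.
apply: (le_trans st).
have -> : (a `^ v + b `^ v) * `|v| / a * `|s - t| =
          (a `^ v + b `^ v) * (`|v| * (`|s - t| / a)) by ring.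
by rewrite ler_pM ?powR_ge0 ?mulr_ge0// ler_wpM2l.
Qed.

(** The exponential dominates its tangent at 0; this is the convexity of
    w |-> t^w in the form of a supporting line at q. *)
Lemma powR_tangent (t q w : R) : 0 < t ->
  t `^ q + (w - q) * (t `^ q * ln t) <= t `^ w.
Proof.
move=> t0; have -> : t `^ w = t `^ q * expR ((w - q) * ln t).
  by rewrite /powR gt_eqF// -expRD; congr expR; ring.
have := ler_wpM2l (powR_ge0 t q) (expR_ge1Dx ((w - q) * ln t)); lra.
Qed.

(** The tangent at q bounds both outer values from below, and the slope cancels
    in this combination. *)
Lemma powR_convex3 (t p q r : R) : 0 < t -> p <= q <= r ->
  (r - p) * t `^ q <= (r - q) * t `^ p + (q - p) * t `^ r.
Proof.
move=> t0 /andP[pq qr].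
have rq : 0 <= r - q by rewrite subr_ge0.
have qp : 0 <= q - p by rewrite subr_ge0.
have := ler_wpM2l rq (@powR_tangent _ q p t0).
have := ler_wpM2l qp (@powR_tangent _ q r t0); lra.
Qed.

(** Outside the interval from a to b a convex function lies above its secant through a and b; the
    form without division serves both w |-> t^w and its reflection. *)
Lemma powR_secant (t a b v : R) : 0 < t -> a < b -> v < a \/ b < v ->
  (b - v) * t `^ a + (v - a) * t `^ b <= (b - a) * t `^ v.
Proof.
move=> t0 ab [va|bv].
  have := @powR_convex3 t v a b t0; rewrite (ltW va) (ltW ab) => /(_ isT); lra.
have := @powR_convex3 t a b v t0; rewrite (ltW bv) (ltW ab) => /(_ isT); lra.
Qed.

Definition heinz_fun (w t : R) : R := (t `^ w + t `^ (1 - w)) / 2.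

(** Both summands of the Heinz function are exponentials in w, and the second one
    is the first one reflected at 1/2, which maps the interval and its exterior
    to those of the reflected endpoints. *)
Lemma heinz_secant (t a b v : R) : 0 < t -> a < b -> v < a \/ b < v ->
  0 <= heinz_fun v t - heinz_fun a t
       - (v - a) / (b - a) * (heinz_fun b t - heinz_fun a t).
Proof.
move=> t0 ab vab; set h := fun w => heinz_fun w t.
have ba : 0 < b - a by rewrite subr_gt0.
rewrite -(pmulr_rge0 _ ba) -!/(h _).
have -> : (b - a) * (h v - h a - (v - a) / (b - a) * (h b - h a)) =
  (b - a) * h v - ((b - v) * h a + (v - a) * h b) by field; rewrite gt_eqF.
have := @powR_secant t a b v t0 ab vab.
have := @powR_secant t (1 - b) (1 - a) (1 - v) t0.
rewrite /h /heinz_fun; set x1 := t `^ v; set x2 := t `^ a; set x3 := t `^ b.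
set y1 := t `^ (1 - v); set y2 := t `^ (1 - a); set y3 := t `^ (1 - b).
move=> H1 H2; have ab' : 1 - b < 1 - a by lra.
have vab' : 1 - v < 1 - b \/ 1 - a < 1 - v.
  by case: vab => ?; [right|left]; rewrite ltrD2l ltrN2.
have := H1 ab' vab'; lra.
Qed.

End scalar.

(** * Real inner product and norm *)

Section hilbert.
Context {R : realType} {H : hilbertType R}.
Implicit Types (x y z : H) (a b c : R) (S T : H -> H).

(** Real parts suffice for symmetric operators, and they bring inequalities into
    the ordered field R. *)
Definition ip x y : R := complex.Re (inner x y).
Definition nrm x : R := complex.Re `|x|.

Lemma nrmE x : `|x| = (nrm x)%:C.
Proof. by rewrite /nrm RRe_real// normr_real. Qed.

Lemma nrm_ge0 x : 0 <= nrm x.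
Proof. by rewrite -lecR -nrmE normr_ge0. Qed.

Lemma nrm0_eq0 x : nrm x = 0 -> x = 0.
Proof. by move=> h; apply/eqP; rewrite -normr_eq0 nrmE h. Qed.

Lemma nrm0 : nrm 0 = 0.
Proof. by apply: complexI; rewrite -nrmE normr0. Qed.

Lemma nrmD x y : nrm (x + y) <= nrm x + nrm y.
Proof. by rewrite -lecR rmorphD/= -!nrmE ler_normD. Qed.

Lemma nrmN x : nrm (- x) = nrm x.
Proof. by rewrite /nrm normrN. Qed.

Lemma nrmB x y : nrm (x - y) = nrm (y - x).
Proof. by rewrite /nrm distrC. Qed.

Lemma nrmZ a x : nrm (a%:C *: x) = `|a| * nrm x.
Proof.
apply: complexI; rewrite -nrmE normrZ nrmE rmorphM/=; congr (_ * _).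
by rewrite normc_def/= expr0n addr0 sqrtr_sqr.
Qed.

Lemma ipxx x : ip x x = nrm x ^+ 2.
Proof.
apply: complexI; rewrite rmorphXn/= -nrmE inner_normE /ip RRe_real//.
by rewrite -inner_normE rpredX// normr_real.
Qed.

Lemma ReD (w u : R[i]) : complex.Re (w + u) = complex.Re w + complex.Re u.
Proof. by case: w u => ? ? []. Qed.

Lemma ReN (w : R[i]) : complex.Re (- w) = - complex.Re w.
Proof. by case: w. Qed.

Lemma ReZ a (w : R[i]) : complex.Re (a%:C * w) = a * complex.Re w.
Proof. by case: w => u v /=; rewrite mul0r subr0. Qed.

Lemma Im_conj (w : R[i]) : complex.Im (Num.conj w) = - complex.Im w.
Proof. by case: w. Qed.

Lemma Re_conj (w : R[i]) : complex.Re (Num.conj w) = complex.Re w. Proof. by case: w. Qed.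

Lemma ipC x y : ip x y = ip y x.
Proof. rewrite /ip hermC expr0 mul1r; exact: Re_conj. Qed.

Lemma ipDl x y z : ip (x + y) z = ip x z + ip y z.
Proof. by rewrite /ip linearDl ReD. Qed.

Lemma ipNl x z : ip (- x) z = - ip x z.
Proof. by rewrite /ip linearNl ReN. Qed.

Lemma ipBl x y z : ip (x - y) z = ip x z - ip y z.
Proof. by rewrite ipDl ipNl. Qed.

Lemma ipZl a x z : ip (a%:C *: x) z = a * ip x z.
Proof. by rewrite /ip linearZl_LR/= ReZ. Qed.

Lemma ipDr x y z : ip z (x + y) = ip z x + ip z y.
Proof. by rewrite ipC ipDl !(ipC z). Qed.
Lemma ipNr x z : ip z (- x) = - ip z x.
Proof. by rewrite ipC ipNl ipC. Qed.
Lemma ipBr x y z : ip z (x - y) = ip z x - ip z y.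
Proof. by rewrite ipDr ipNr. Qed.
Lemma ipZr a x z : ip z (a%:C *: x) = a * ip z x.
Proof. by rewrite ipC ipZl ipC. Qed.

(** Multiplying the first argument by the imaginary unit recovers the imaginary
    part, so identities between the real forms of complex-linear operators lift
    to the complex inner product. *)
Lemma ip_im x y : complex.Im (inner x y) = - ip ('i *: x) y.
Proof. by rewrite /ip linearZl_LR/= mulrC ReiNIm opprK. Qed.

Lemma ip0l x : ip 0 x = 0.
Proof. by rewrite -(subrr 0) ipBl subrr. Qed.

Lemma nrm_sqB x y : nrm (x - y) ^+ 2 = nrm x ^+ 2 - 2 * ip x y + nrm y ^+ 2.
Proof. by rewrite -!ipxx !ipBl !ipBr (ipC y x); ring. Qed.

(** The squared norm of |y| x - |x| y is nonnegative. *)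
Lemma ip_le x y : ip x y <= nrm x * nrm y.
Proof.
have [/eqP|xy] := eqVneq (nrm x * nrm y) 0.
  rewrite mulf_eq0 => /orP[] /eqP/nrm0_eq0 ->.
    by rewrite ip0l mulr_ge0 ?nrm_ge0.
  by rewrite ipC ip0l mulr_ge0 ?nrm_ge0.
have xy0 : 0 < nrm x * nrm y by rewrite lt_neqAle eq_sym xy mulr_ge0 ?nrm_ge0.
have := sqr_ge0 (nrm ((nrm y)%:C *: x - (nrm x)%:C *: y)).
rewrite nrm_sqB !nrmZ !ipZl !ipZr !exprMn !real_normK ?num_real//.
rewrite -[_ <= _ * _](ler_pM2l xy0); lra.
Qed.

Lemma bounded_opP T : bounded_op T <->
  linear T /\ exists M : R, 0 < M /\ forall x, nrm (T x) <= M * nrm x.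
Proof.
split=> -[lT [M hM]]; split=> //.
  exists (Num.max M 1); split; first by rewrite lt_max ltr01 orbT.
  move=> x; have := hM x; rewrite !nrmE -rmorphM lecR => /le_trans; apply.
  by rewrite ler_wpM2r ?nrm_ge0// le_max lexx.
by exists M => x; rewrite !nrmE -rmorphM lecR; case: hM.
Qed.

Section linear_map.
Variables (T : H -> H) (lT : linear T).

Lemma linD x y : T (x + y) = T x + T y.
Proof. by rewrite -[x]scale1r lT !scale1r. Qed.

Lemma lin0 : T 0 = 0.
Proof. by apply: (addrI (T 0)); rewrite -linD !addr0. Qed.

Lemma linZ k x : T (k *: x) = k *: T x.
Proof. by rewrite -[k *: x]addr0 lT lin0 addr0. Qed.

Lemma linN x : T (- x) = - T x.
Proof. by rewrite -scaleN1r linZ scaleN1r. Qed.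

Lemma linB x y : T (x - y) = T x - T y.
Proof. by rewrite linD linN. Qed.

End linear_map.

Lemma self_adjointP T :
  self_adjoint T <-> bounded_op T /\ forall x y, ip (T x) y = ip x (T y).
Proof.
split=> -[bT h]; split=> // x y; first by rewrite /ip h.
apply/eqP; rewrite eq_complex; apply/andP; split; apply/eqP; first exact: h.
by rewrite !ip_im -h (linZ bT.1).
Qed.

Lemma positive_opP T :
  positive_op T <-> self_adjoint T /\ forall x, 0 <= ip (T x) x.
Proof.
split=> -[sT h]; split=> // x; first by move: (h x); rewrite lecE => /andP[].
rewrite lecE h andbT; apply/eqP.
have : complex.Im (inner (T x) x) = - complex.Im (inner (T x) x).
  by rewrite -Im_conj; congr complex.Im; rewrite [LHS]sT.2 hermC expr0 mul1r.
by move=> hh; lra.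
Qed.

End hilbert.

(** * Bounded operators, completeness and Neumann series *)

Section bounded.
Context {R : realType} {H : hilbertType R}.
Implicit Types (x y z : H) (a b c : R) (S T : H -> H).

Lemma nrmZc (k : R[i]) x : nrm (k *: x) = complex.Re `|k| * nrm x.
Proof.
apply: complexI; rewrite -nrmE normrZ nrmE rmorphM/=; congr (_ * _).
Qed.

Lemma bounded_id : bounded_op (id : H -> H).
Proof.
by apply/bounded_opP; split=> //; exists 1; split=> // x; rewrite mul1r.
Qed.

Lemma bounded_comp S T : bounded_op S -> bounded_op T -> bounded_op (S \o T).
Proof.
move=> /bounded_opP[lS [M [M0 hM]]] /bounded_opP[lT [N [N0 hN]]].
apply/bounded_opP; split; first by move=> k u v /=; rewrite lT lS.
exists (M * N); split; first exact: mulr_gt0.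
by move=> x /=; rewrite (le_trans (hM _))// -mulrA ler_wpM2l// ltW.
Qed.

Lemma bounded_add S T : bounded_op S -> bounded_op T -> bounded_op (S + T).
Proof.
move=> /bounded_opP[lS [M [M0 hM]]] /bounded_opP[lT [N [N0 hN]]].
apply/bounded_opP; split.
  by move=> k u v; rewrite addrfctE lT lS scalerDr addrACA.
exists (M + N); split; first exact: addr_gt0.
by move=> x; rewrite addrfctE (le_trans (nrmD _ _))// mulrDl lerD.
Qed.

Lemma bounded_scale (k : R[i]) T : bounded_op T -> bounded_op (k *: T).
Proof.
move=> /bounded_opP[lT [N [N0 hN]]].
have k0 : 0 <= complex.Re `|k| by rewrite -lecR RRe_real ?normr_real ?normr_ge0.
apply/bounded_opP; split.
  by move=> l u v; rewrite scalrfctE lT scalerDr !scalerA mulrC.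
exists ((complex.Re `|k| + 1) * N); split; first by rewrite mulr_gt0// ltr_wpDl.
move=> x; rewrite scalrfctE nrmZc -mulrA ler_pM ?nrm_ge0//.
by rewrite lerDl.
Qed.

Lemma bounded_sub S T : bounded_op S -> bounded_op T -> bounded_op (S - T).
Proof.
move=> bS bT; have -> : S - T = S + (-1) *: T by rewrite scaleN1r.
exact/bounded_add/bounded_scale.
Qed.

Lemma self_adjoint_id : self_adjoint (id : H -> H).
Proof. by apply/self_adjointP; split=> //; exact: bounded_id. Qed.

Lemma self_adjoint_add S T :
  self_adjoint S -> self_adjoint T -> self_adjoint (S + T).
Proof.
move=> /self_adjointP[bS hS] /self_adjointP[bT hT]; apply/self_adjointP.
split; first exact: bounded_add.
by move=> x y; rewrite addrfctE ipDl ipDr hS hT.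
Qed.

Lemma self_adjoint_scale a T : self_adjoint T -> self_adjoint (a%:C *: T).
Proof.
move=> /self_adjointP[bT hT]; apply/self_adjointP.
split; first exact: bounded_scale.
by move=> x y; rewrite scalrfctE ipZl ipZr hT.
Qed.

Lemma self_adjoint_sub S T :
  self_adjoint S -> self_adjoint T -> self_adjoint (S - T).
Proof.
move=> aS aT; have -> : S - T = S + (-1)%:C *: T.
  by rewrite rmorphN1 scaleN1r.
exact/self_adjoint_add/self_adjoint_scale.
Qed.

Lemma self_adjoint_conj S T :
  self_adjoint S -> self_adjoint T -> self_adjoint (S \o T \o S).
Proof.
move=> /self_adjointP[bS hS] /self_adjointP[bT hT]; apply/self_adjointP.
split; first by apply: bounded_comp => //; exact: bounded_comp.
by move=> x y /=; rewrite hS hT hS.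
Qed.

(** Completeness of H, with real tolerances in place of filters. *)
Lemma nrm_complete (u : nat -> H) :
  (forall e : R, 0 < e -> exists N, forall m n, (N <= m)%N -> (N <= n)%N ->
     nrm (u m - u n) <= e) ->
  exists l, forall e : R, 0 < e -> exists N, forall n, (N <= n)%N ->
     nrm (u n - l) <= e.
Proof.
move=> hu.
have /cauchy_cvgP cu : cauchy (u @ \oo)%classic.
  apply/cauchy_ballP => e e0; near_simpl.
  have eE : e = (complex.Re e)%:C by rewrite RRe_real// gtr0_real.
  have e0' : 0 < complex.Re e by rewrite -ltcR -eE.
  have [|N hN] := hu (complex.Re e / 2); first by lra.
  exists ([set n | (N <= n)%N], [set n | (N <= n)%N])%classic.
    by split; exists N.
  move=> [m n] [/= hm hn]; rewrite -ball_normE /= nrmE eE ltcR.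
  by apply: (le_lt_trans (hN _ _ hm hn)); lra.
exists (lim (u @ \oo)%classic) => e e0.
have e0' : 0 < e%:C by rewrite ltcR.
have /cvgrPdist_le/(_ _ e0')[N _ hN] := cu.
by exists N => n Nn; have := hN n Nn; rewrite nrmE lecR nrmB.
Qed.

(** The iterates of x |-> y + K x form a Cauchy sequence, and their limit is the
    sum of the Neumann series applied to y. *)
Lemma neumann K c : linear K -> 0 <= c < 1 ->
  (forall x, nrm (K x) <= c * nrm x) -> forall y, exists x, x - K x = y.
Proof.
move=> lK /andP[c0 c1] hK y.
pose u n := iter n (fun x => y + K x) 0.
have d0 : 0 < 1 - c by rewrite subr_gt0.
have uB k : nrm (u k) <= nrm y / (1 - c).
  elim: k => [|k IH]; first by rewrite /= nrm0 divr_ge0 ?nrm_ge0// ltW.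
  rewrite [u _]/= (le_trans (nrmD _ _))// (le_trans (lerD (lexx _) (hK _)))//.
  rewrite (le_trans (lerD (lexx _) (ler_wpM2l c0 IH)))//.
  by rewrite le_eqVlt; apply/orP; left; apply/eqP; field; rewrite gt_eqF.
have uD n k : nrm (u (n + k)%N - u n) <= c ^+ n * (nrm y / (1 - c)).
  elim: n => [|n IH]; first by rewrite add0n [u 0%N]/= subr0 mul1r.
  rewrite addSn [u _.+1]/= [u n.+1]/= [y + _]addrC addrKA -(linB lK).
  by rewrite (le_trans (hK _))// exprS -mulrA ler_wpM2l.
have gz (e : R) : 0 < e -> exists N, c ^+ N * (nrm y / (1 - c)) <= e.
  move=> e0; set B := nrm y / (1 - c).
  have B0 : 0 <= B by rewrite divr_ge0 ?nrm_ge0 ?ltW.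
  have e1 : 0 < e / (B + 1) by rewrite divr_gt0// ltr_wpDl.
  have /cvgrPdist_le/(_ _ e1)[N _ hN] : (c ^+ n @[n --> \oo] --> (0 : R))%classic.
    by apply: cvg_expr; rewrite ger0_norm.
  exists N; have := hN N (leqnn N); rewrite sub0r normrN ger0_norm ?exprn_ge0//.
  rewrite ler_pdivlMr ?ltr_wpDl//; apply: le_trans.
  by rewrite ler_wpM2l ?exprn_ge0// lerDl.
have [|l hl] := @nrm_complete u.
  move=> e e0; have [|N hN] := gz (e / 2); first by lra.
  exists N => m n Nm Nn; rewrite -(subnKC Nm) -(subnKC Nn).
  have -> : u (N + (m - N))%N - u (N + (n - N))%N =
    (u (N + (m - N))%N - u N) - (u (N + (n - N))%N - u N) by rewrite opprB addrA subrK.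
  rewrite (le_trans (nrmD _ _))// nrmN.
  by have := uD N (m - N)%N; have := uD N (n - N)%N; lra.
exists l; apply/eqP; rewrite -subr_eq0; apply/eqP/nrm0_eq0.
apply/eqP; rewrite eq_le nrm_ge0 andbT; apply/ler_addgt0Pl => e e0; rewrite addr0.
have [|N hN] := hl (e / 2); first by lra.
have h1 := hN N.+1 (leqnSn N); have h2 := hN N (leqnn N).
have -> : l - K l - y = (K (u N) - K l) - (u N.+1 - l).
  rewrite [u N.+1]/=; move: (K (u N)) (K l) => p q.
  by rewrite opprB opprD [RHS]addrC -!addrA addKr [- q - y]addrC.
rewrite (le_trans (nrmD _ _))// nrmN -(linB lK).
have := hK (u N - l); have := nrm_ge0 (u N - l); nra.
Qed.

End bounded.

(** * Coercive operators and the reality of the spectrum *)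

Section spectral.
Context {R : realType} {H : hilbertType R}.
Implicit Types (x y z : H) (a b c : R) (S T : H -> H).

Lemma bounded_below_invertible T c : bounded_op T -> 0 < c ->
  (forall x, c * nrm x <= nrm (T x)) -> (forall y, exists x, T x = y) ->
  invertible_op T.
Proof.
move=> bT c0 hT /choice[S ST]; have lT := bT.1.
have Tinj : injective T.
  move=> x y xy; apply/eqP; rewrite -subr_eq0; apply/eqP/nrm0_eq0/eqP.
  rewrite eq_le nrm_ge0 andbT -(ler_pM2l c0) (le_trans (hT _))// (linB lT) xy.
  by rewrite subrr nrm0 mulr0.
split=> //; exists S; split=> //; last by move=> x; exact: Tinj.
apply/bounded_opP; split; first by move=> k u v; apply: Tinj; rewrite lT !ST.
exists c^-1; split; first by rewrite invr_gt0.
by move=> x; rewrite mulrC ler_pdivlMr// mulrC -[in leRHS](ST x).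
Qed.

Lemma form_bounded T : bounded_op T ->
  exists c, 0 < c /\ forall x, ip (T x) x <= c * nrm x ^+ 2.
Proof.
move=> /bounded_opP[_ [M [M0 hM]]]; exists M; split=> // x.
by rewrite (le_trans (ip_le _ _))// expr2 mulrA ler_wpM2r// nrm_ge0.
Qed.

(** Evaluate the positive form of S at c x - S x. It is the
    Cauchy-Schwarz inequality for that form at x and S x. *)
Lemma form_sq_bound S c : self_adjoint S -> 0 < c ->
  (forall x, 0 <= ip (S x) x) -> (forall x, ip (S x) x <= c * nrm x ^+ 2) ->
  forall x, nrm (S x) ^+ 2 <= c * ip (S x) x.
Proof.
move=> /self_adjointP[bS sS] c0 S0 Sc x; have lS := bS.1.
have := S0 (c%:C *: x - S x); have := Sc (S x).
rewrite (linB lS) (linZ lS) !ipBl !ipBr !ipZl !ipZr (sS (S x) x) ipxx => h1 h2.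
by rewrite -(ler_pM2l c0); lra.
Qed.

(** If c <= S <= M then K = 1 - S / (M + c) satisfies 0 <= K <= M / (M + c) < 1,
    so K is a contraction and 1 - K is onto by the Neumann series. *)
Lemma coercive_invertible S c : self_adjoint S -> 0 < c ->
  (forall x, c * nrm x ^+ 2 <= ip (S x) x) -> invertible_op S.
Proof.
move=> aS c0 hc; have /self_adjointP[bS sS] := aS; have lS := bS.1.
have [M [M0 hM]] := form_bounded bS.
have d0 : 0 < M + c by exact: addr_gt0.
have dN : M + c != 0 by rewrite gt_eqF.
pose K : H -> H := id - ((M + c)^-1)%:C *: S.
have KE x : K x = x - ((M + c)^-1)%:C *: S x by [].
have aK : self_adjoint K.
  by apply: self_adjoint_sub; [exact: self_adjoint_id|exact: self_adjoint_scale].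
have KfE x : ip (K x) x = nrm x ^+ 2 - ip (S x) x / (M + c).
  by rewrite KE ipBl ipZl ipxx mulrC.
have r0 : 0 < M / (M + c) by rewrite divr_gt0.
have K1 x : ip (K x) x <= M / (M + c) * nrm x ^+ 2.
  rewrite KfE -(ler_pM2l d0).
  have -> : (M + c) * (nrm x ^+ 2 - ip (S x) x / (M + c)) =
    (M + c) * nrm x ^+ 2 - ip (S x) x by field.
  have -> : (M + c) * (M / (M + c) * nrm x ^+ 2) = M * nrm x ^+ 2 by field.
  have := hc x; lra.
have K0 x : 0 <= ip (K x) x.
  rewrite KfE -(pmulr_rge0 _ d0).
  have -> : (M + c) * (nrm x ^+ 2 - ip (S x) x / (M + c)) =
    (M + c) * nrm x ^+ 2 - ip (S x) x by field.
  have := hM x; have := mulr_ge0 (ltW c0) (sqr_ge0 (nrm x)); lra.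
have Kb x : nrm (K x) <= M / (M + c) * nrm x.
  rewrite -(ler_pXn2r (ltn0Sn 1)) ?nnegrE ?nrm_ge0 ?(mulr_ge0 (ltW r0) (nrm_ge0 x))//.
  apply: (le_trans (form_sq_bound aK r0 K0 K1 x)).
  rewrite exprMn (expr2 (M / _)) -(mulrA _ _ (nrm x ^+ 2)).
  by apply: ler_wpM2l; [exact: ltW|exact: K1].
apply: (bounded_below_invertible bS c0).
  move=> x; have [->|x0] := eqVneq (nrm x) 0; first by rewrite mulr0 nrm_ge0.
  have xp : 0 < nrm x by rewrite lt_neqAle eq_sym x0 nrm_ge0.
  rewrite -(ler_pM2r xp) -mulrA -expr2 (le_trans (hc x))//.
  exact: ip_le.
move=> y; have [|x hx] := neumann aK.1.1 _ Kb ((M + c)^-1%:C *: y).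
  by rewrite (ltW r0) ltr_pdivrMr// mul1r ltrDl.
exists x; have : (M + c)%:C *: (x - K x) = (M + c)%:C *: ((M + c)^-1%:C *: y).
  by rewrite hx.
rewrite KE opprB addrCA subrr addr0 !scalerA -rmorphM/= divff// !scale1r.
by [].
Qed.

(** If T is the inverse of S then |x| is at most a multiple of |S x|, whose square
    is controlled by the form of S. *)
Lemma positive_coercive S : self_adjoint S -> (forall x, 0 <= ip (S x) x) ->
  invertible_op S -> exists c, 0 < c /\ forall x, c * nrm x ^+ 2 <= ip (S x) x.
Proof.
move=> aS S0 [bS [T [bT TS ST]]].
have [c [c0 hc]] := form_bounded bS.
have /bounded_opP[_ [M [M0 hM]]] := bT.
have d0 : 0 < c * M ^+ 2 by rewrite mulr_gt0// exprn_gt0.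
exists (c * M ^+ 2)^-1; split; first by rewrite invr_gt0.
move=> x; rewrite mulrC ler_pdivrMr//.
have : nrm x ^+ 2 <= (M * nrm (S x)) ^+ 2.
  rewrite ler_pXn2r ?nnegrE ?mulr_ge0 ?nrm_ge0 ?(ltW M0)//.
  by have := hM (S x); rewrite ST.
rewrite exprMn => /le_trans; apply.
have := ler_wpM2l (sqr_ge0 M) (form_sq_bound aS c0 S0 hc x); lra.
Qed.

Lemma invertible_comp S T :
  invertible_op S -> invertible_op T -> invertible_op (S \o T).
Proof.
move=> [bS [S' [bS' h1 h2]]] [bT [T' [bT' h3 h4]]].
split; first exact: bounded_comp.
exists (T' \o S'); split; first exact: bounded_comp.
  by move=> x /=; rewrite h3 h1.
by move=> x /=; rewrite h2 h4.
Qed.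

(** The inverse U of S T commutes with S, and then U S inverts T on both sides. *)
Lemma invertible_factor S T : bounded_op S -> bounded_op T ->
  S \o T =1 T \o S -> invertible_op (S \o T) -> invertible_op T.
Proof.
move=> bS bT cST [_ [U [bU h1 h2]]]; split=> //.
have TSU y : T (S (U y)) = y by have := h1 y; rewrite cST.
have US y : U (S y) = S (U y).
  apply: (can_inj h2); rewrite -[LHS]/(S (T (U (S y)))).
  by rewrite -[RHS]/(S (T (S (U y)))) TSU; exact: h1.
exists (U \o S); split; first exact: bounded_comp.
  by move=> x /=; rewrite US.
by move=> x; exact: h2.
Qed.

(** With z = a + i b and D = T - a, the operator T - z is a factor of
    (D + i b) (D - i b) = D^2 + b^2, which is coercive with constant b^2. *)
Lemma self_adjoint_spectrum_real T (z : R[i]) : self_adjoint T ->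
  complex.Im z != 0 -> ~ spectrum T z.
Proof.
move=> aT z0; apply; have bT := aT.1; have lT := bT.1.
pose a := complex.Re z; pose b := complex.Im z.
pose D : H -> H := T - a%:C *: id.
have aD : self_adjoint D.
  by apply: self_adjoint_sub => //; apply/self_adjoint_scale/self_adjoint_id.
have /self_adjointP[bD sD] := aD; have lD := bD.1.
have zE : z = a%:C + 'i * b%:C by exact: complexE.
pose k := 'i%C * b%:C.
(* T1 is T - z, and T2 is T minus the conjugate of z. *)
pose T1 : H -> H := D - k *: id.
pose T2 : H -> H := D + k *: id.
have -> : (fun x => T x - z *: x) = T1.
  by apply/funext => x; rewrite zE scalerDl opprD addrA.
have T21 x : T2 (T1 x) = D (D x) + (b ^+ 2)%:C *: x.
  rewrite -[T2 _]/(D (D x - k *: x) + k *: (D x - k *: x)).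
  rewrite (linB lD) (linZ lD) (scalerBr k (D x)) (scalerA k k) addrA subrK.
  congr (_ + _).
  rewrite -scaleNr; congr (_ *: _).
  by rewrite /k mulrACA -expr2 sqr_i mulN1r opprK -rmorphM -expr2.
have T12 x : T1 (T2 x) = D (D x) + (b ^+ 2)%:C *: x.
  rewrite -[T1 _]/(D (D x + k *: x) - k *: (D x + k *: x)).
  rewrite (linD lD) (linZ lD) (scalerDr k (D x)) (scalerA k k) opprD addrA addrK.
  congr (_ + _).
  rewrite -scaleNr; congr (_ *: _).
  by rewrite /k mulrACA -expr2 sqr_i mulN1r opprK -rmorphM -expr2.
have bk : bounded_op (k *: (id : H -> H)) by exact/bounded_scale/bounded_id.
apply: (@invertible_factor T2 T1); [exact: bounded_add|exact: bounded_sub| |].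
  by move=> x; rewrite [LHS]T21 [RHS]T12.
have -> : T2 \o T1 = (D \o id \o D) + (b ^+ 2)%:C *: id.
  by apply/funext => x; exact: T21.
have b0 : 0 < b ^+ 2 by rewrite exprn_even_gt0.
apply: (@coercive_invertible _ (b ^+ 2)) => //.
  apply: self_adjoint_add.
    by apply: self_adjoint_conj => //; exact: self_adjoint_id.
  exact/self_adjoint_scale/self_adjoint_id.
move=> x; rewrite -[(_ + _) x]/(D (D x) + (b ^+ 2)%:C *: x) ipDl ipZl sD !ipxx.
by rewrite lerDr sqr_ge0.
Qed.

End spectral.

(** * Complex polynomials of an operator *)

Section polynomial.
Context {R : realType} {H : hilbertType R}.
Implicit Types (x y : H) (S T : H -> H).

Lemma invertible_scale (k : R[i]) : k != 0 ->
  invertible_op (fun x : H => k *: x).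
Proof.
move=> k0; split; first exact/bounded_scale/bounded_id.
exists (fun x => k^-1 *: x); split.
- exact/bounded_scale/bounded_id.
- by move=> x; rewrite scalerA divff// scale1r.
- by move=> x; rewrite scalerA mulVf// scale1r.
Qed.

(** Complex coefficients are needed to split a real polynomial into linear
    factors. *)
Definition cpoly_op (p : {poly R[i]}) T : H -> H :=
  fun x => \sum_(i < size p) p`_i *: iter i T x.

Lemma cpoly_op_widen n (p : {poly R[i]}) T x : (size p <= n)%N ->
  cpoly_op p T x = \sum_(i < n) p`_i *: iter i T x.
Proof.
move=> pn; rewrite /cpoly_op (big_ord_widen n (fun i => p`_i *: iter i T x)) //.
rewrite big_mkcond /=; apply: eq_bigr => i _; case: ltnP => // ip.
by rewrite nth_default// scale0r.
Qed.

Lemma cpoly_opD p q T x :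
  cpoly_op (p + q) T x = cpoly_op p T x + cpoly_op q T x.
Proof.
pose n := maxn (size p) (size q).
rewrite (@cpoly_op_widen n p) ?leq_maxl// (@cpoly_op_widen n q) ?leq_maxr//.
rewrite (@cpoly_op_widen n) ?size_polyD//.
by rewrite -big_split/=; apply: eq_bigr => i _; rewrite coefD scalerDl.
Qed.

Lemma cpoly_opC (k : R[i]) T x : cpoly_op k%:P T x = k *: x.
Proof.
rewrite (@cpoly_op_widen 1) ?size_polyC_leq1//.
by rewrite big_ord1 coefC.
Qed.

Lemma cpoly_opMX p T x : cpoly_op (p * 'X) T x = cpoly_op p T (T x).
Proof.
rewrite (@cpoly_op_widen (size p).+1); last first.
  by rewrite (leq_trans (size_polyMleq _ _))// size_polyX addn2.
rewrite big_ord_recl coefMX scale0r add0r; apply: eq_bigr => i _.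
by rewrite coefMX /= -iterS iterSr.
Qed.

Lemma cpoly_op_linear p T : linear T -> linear (cpoly_op p T).
Proof.
move=> lT; elim/poly_ind: p => [|p c IH] k x y.
  by rewrite -polyC0 !cpoly_opC !scale0r scaler0 addr0.
rewrite !cpoly_opD !cpoly_opMX !cpoly_opC lT IH !scalerDr !scalerA (mulrC c).
by rewrite addrACA.
Qed.

Lemma cpoly_op_comm p T x : linear T -> cpoly_op p T (T x) = T (cpoly_op p T x).
Proof.
move=> lT; elim/poly_ind: p x => [|p c IH] x.
  by rewrite -polyC0 !cpoly_opC !scale0r (lin0 lT).
by rewrite !cpoly_opD !cpoly_opMX !cpoly_opC (linD lT) (linZ lT) IH.
Qed.

Lemma cpoly_opM p q T x : linear T ->
  cpoly_op (p * q) T x = cpoly_op p T (cpoly_op q T x).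
Proof.
move=> lT; elim/poly_ind: p x => [|p c IH] x.
  by rewrite mul0r -polyC0 !cpoly_opC !scale0r.
rewrite mulrDl -mulrA ['X * q]mulrC mulrA cpoly_opD cpoly_opMX IH.
rewrite cpoly_opD cpoly_opMX cpoly_opC cpoly_op_comm//; congr (_ + _).
elim/poly_ind: q {IH} x => [|q d IH] x.
  by rewrite mulr0 -polyC0 !cpoly_opC !scale0r scaler0.
by rewrite mulrDr mulrA -polyCM !cpoly_opD !cpoly_opMX !cpoly_opC IH scalerDr scalerA.
Qed.

Lemma cpoly_op_bounded p T : bounded_op T -> bounded_op (cpoly_op p T).
Proof.
move=> bT; elim/poly_ind: p => [|p c IH].
  have -> : cpoly_op 0 T = 0 *: id.
    by apply/funext => x; rewrite -polyC0 cpoly_opC.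
  exact/bounded_scale/bounded_id.
have -> : cpoly_op (p * 'X + c%:P) T = cpoly_op p T \o T + c *: id.
  by apply/funext => x; rewrite cpoly_opD cpoly_opMX cpoly_opC.
by apply: bounded_add; [exact: bounded_comp|exact/bounded_scale/bounded_id].
Qed.

(** Over the complex numbers p(T) is a product of factors T - z with z a root;
    each is invertible, by hypothesis if z is real and by
    [self_adjoint_spectrum_real] otherwise. *)
Lemma cpoly_op_invertible T (p : {poly R[i]}) : self_adjoint T -> p != 0 ->
  (forall t : R, root p t%:C -> ~ spectrum T t%:C) ->
  invertible_op (cpoly_op p T).
Proof.
move=> aT p0 pT; have bT := aT.1; have lT := bT.1.
have [r pE] := closed_field_poly_normal p.
have lp0 : lead_coef p != 0 by rewrite lead_coef_eq0.
have rT z : z \in r -> invertible_op (fun x => T x - z *: x).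
  move=> zr; apply: contrapT => sz; have [Iz|Iz] := eqVneq (complex.Im z) 0.
    have zE : z = (complex.Re z)%:C by rewrite {1}(complexE z) Iz mulr0 addr0.
    apply: (pT (complex.Re z)); rewrite -zE // pE rootZ// root_prod_XsubC.
    exact: zr.
  exact: (self_adjoint_spectrum_real aT Iz).
have {}rT : invertible_op (cpoly_op (\prod_(z <- r) ('X - z%:P)) T).
  elim: r rT {pE} => [|z r IH] rT.
    rewrite big_nil.
    have -> : cpoly_op 1 T = id.
      by apply/funext => x; rewrite -polyC1 cpoly_opC scale1r.
    by split; [exact: bounded_id|exists id; split=> //; exact: bounded_id].
  rewrite big_cons.
  have -> : cpoly_op (('X - z%:P) * \prod_(j <- r) ('X - j%:P)) T =
    (fun x => T x - z *: x) \o cpoly_op (\prod_(j <- r) ('X - j%:P)) T.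
    apply/funext => x; rewrite cpoly_opM// -['X]mul1r -polyCN.
    by rewrite cpoly_opD cpoly_opMX -polyC1 !cpoly_opC scale1r scaleNr.
  apply: invertible_comp; first by apply: rT; exact: mem_head.
  by apply: IH => w wr; apply: rT; rewrite in_cons wr orbT.
have -> : cpoly_op p T =
    (fun x => lead_coef p *: x) \o cpoly_op (\prod_(z <- r) ('X - z%:P)) T.
  by apply/funext => x; rewrite [in LHS]pE -mul_polyC cpoly_opM// cpoly_opC.
by apply: invertible_comp => //; exact: invertible_scale.
Qed.

End polynomial.

(** * Real polynomials of a self-adjoint operator *)

Section calculus.
Context {R : realType} {H : hilbertType R}.
Implicit Types (x y : H) (S T : H -> H) (p q : {poly R}) (e : R).

Lemma poly_opE p T x : poly_op p T x = cpoly_op (map_poly (real_complex R) p) T x.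
Proof.
rewrite /poly_op /cpoly_op size_map_poly.
by apply: eq_bigr => i _; rewrite coef_map.
Qed.

Lemma poly_opD p q T x : poly_op (p + q) T x = poly_op p T x + poly_op q T x.
Proof. by rewrite !poly_opE rmorphD cpoly_opD. Qed.

Lemma poly_opC (k : R) T x : poly_op k%:P T x = k%:C *: x.
Proof. by rewrite !poly_opE map_polyC cpoly_opC. Qed.

Lemma poly_opMX p T x : poly_op (p * 'X) T x = poly_op p T (T x).
Proof. by rewrite !poly_opE rmorphM/= map_polyX cpoly_opMX. Qed.

Lemma poly_opX T x : poly_op 'X T x = T x.
Proof. by rewrite -['X]mul1r poly_opMX -polyC1 poly_opC scale1r. Qed.

Lemma poly_opM p q T x : linear T ->
  poly_op (p * q) T x = poly_op p T (poly_op q T x).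
Proof. by move=> lT; rewrite !poly_opE rmorphM/= cpoly_opM. Qed.

Lemma poly_opZ (k : R) p T x : linear T ->
  poly_op (k *: p) T x = k%:C *: poly_op p T x.
Proof. by move=> lT; rewrite -mul_polyC poly_opM// poly_opC. Qed.

Lemma poly_opB p q T x : linear T ->
  poly_op (p - q) T x = poly_op p T x - poly_op q T x.
Proof.
by move=> lT; rewrite -scaleN1r poly_opD poly_opZ// rmorphN1 scaleN1r.
Qed.

Lemma poly_op_linear p T : linear T -> linear (poly_op p T).
Proof. by move=> lT k x y; rewrite !poly_opE cpoly_op_linear. Qed.

Lemma poly_op_self_adjoint p T : self_adjoint T -> self_adjoint (poly_op p T).
Proof.
move=> aT; have lT := aT.1.1; have /self_adjointP[bT sT] := aT.
apply/self_adjointP; split.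
  have -> : poly_op p T = cpoly_op (map_poly (real_complex R) p) T.
    by apply/funext => x; rewrite poly_opE.
  exact: cpoly_op_bounded.
elim/poly_ind: p => [|p c IH] x y.
  by rewrite -polyC0 !poly_opC !ipZl !ipZr !mul0r.
rewrite !poly_opD !poly_opMX !poly_opC ipDl ipDr ipZl ipZr; congr (_ + _).
by rewrite IH sT !poly_opE cpoly_op_comm.
Qed.

Lemma poly_op_invertible p T : self_adjoint T -> p != 0 ->
  (forall t : R, root p t -> ~ spectrum T t%:C) -> invertible_op (poly_op p T).
Proof.
move=> aT p0 pT.
have -> : poly_op p T = cpoly_op (map_poly (real_complex R) p) T.
  by apply/funext => x; rewrite poly_opE.
apply: cpoly_op_invertible => //; first by rewrite map_poly_eq0.
by move=> t rt; apply: pT; rewrite -(fmorph_root (real_complex R)).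
Qed.

(** The argument by the largest lower bound m of the form of q(T): if m were
    negative, q - m would have no root in the spectrum, so q(T) - m would be
    invertible and m could be increased. The size hypothesis makes q - m nonzero
    for every m. *)
Lemma poly_op_ge0_nonconst q T : self_adjoint T -> (1 < size q)%N ->
  (forall t : R, spectrum T t%:C -> 0 <= q.[t]) ->
  forall x, 0 <= ip (poly_op q T x) x.
Proof.
move=> aT q1 qT; have lT := aT.1.1; set S := poly_op q T.
have aS : self_adjoint S by exact: poly_op_self_adjoint.
apply: contrapT => /existsNP[x0 /negP]; rewrite -ltNge => Sx0.
pose E := [set m : R | forall x, m * nrm x ^+ 2 <= ip (S x) x]%classic.
have x0p : 0 < nrm x0 ^+ 2.
  rewrite exprn_gt0// lt_neqAle nrm_ge0 andbT eq_sym; apply/eqP => /nrm0_eq0 xE.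
  by move: Sx0; rewrite xE ipC ip0l ltxx.
have ubE : ubound E (ip (S x0) x0 / nrm x0 ^+ 2).
  by move=> m Em; rewrite ler_pdivlMr// Em.
have supE : has_sup E.
  split; last by exists (ip (S x0) x0 / nrm x0 ^+ 2).
  have [M [M0 hM]] := form_bounded (bounded_scale (-1) aS.1).
  by exists (- M) => x; have := hM x; rewrite scalrfctE scaleN1r ipNl; lra.
pose m := sup E.
have m0 : m < 0.
  apply: (@le_lt_trans _ _ (ip (S x0) x0 / nrm x0 ^+ 2)).
    by apply: ge_sup => //; exact: supE.1.
  by rewrite pmulr_llt0// invr_gt0.
have Em x : m * nrm x ^+ 2 <= ip (S x) x.
  have [x00|x00] := eqVneq (nrm x) 0.
    by rewrite (nrm0_eq0 x00) nrm0 expr0n mulr0 ipC ip0l.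
  have xp : 0 < nrm x ^+ 2 by rewrite exprn_gt0// lt_neqAle nrm_ge0 andbT eq_sym.
  rewrite -ler_pdivlMr//; apply: ge_sup; first exact: supE.1.
  by move=> k Ek; rewrite ler_pdivlMr.
have aSm : self_adjoint (poly_op (q - m%:P) T) by exact: poly_op_self_adjoint.
have Sm x : ip (poly_op (q - m%:P) T x) x = ip (S x) x - m * nrm x ^+ 2.
  by rewrite poly_opB// poly_opC ipBl ipZl ipxx.
have [||c [c0 hc]] := positive_coercive aSm.
- by move=> x; rewrite Sm subr_ge0.
- apply: poly_op_invertible => //.
    apply: contraTneq q1 => /eqP; rewrite subr_eq0 => /eqP ->.
    by rewrite -leqNgt size_polyC_leq1.
  move=> t; rewrite rootE !hornerE subr_eq0 => /eqP qt /qT.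
  by rewrite qt leNgt m0.
have : m + c <= m.
  apply: ub_le_sup; first exact: supE.2.
  by move=> x; have := hc x; rewrite Sm; lra.
by rewrite leNgt ltrDl c0.
Qed.

(** A negative constant q would force the real spectrum to be empty; then the
    nonconstant case applies to every X - c, which is absurd for large c unless
    x is 0. *)
Lemma poly_op_ge0 q T : self_adjoint T ->
  (forall t : R, spectrum T t%:C -> 0 <= q.[t]) ->
  forall x, 0 <= ip (poly_op q T x) x.
Proof.
move=> aT qT x; have lT := aT.1.1; have [q1|q1] := ltnP 1 (size q).
  exact: poly_op_ge0_nonconst.
have qE := size1_polyC q1; set c := q`_0 in qE.
rewrite qE poly_opC ipZl ipxx.
have [c0|c0] := leP 0 c; first by rewrite mulr_ge0 ?sqr_ge0.
have sp0 t : ~ spectrum T t%:C.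
  by move=> /qT; rewrite qE hornerC leNgt c0.
have [M [M0 hM]] := form_bounded aT.1.
have := @poly_op_ge0_nonconst ('X - (M + 1)%:P) T aT.
rewrite size_XsubC => /(_ isT (fun t st => False_ind _ (sp0 t st)) x).
rewrite poly_opB// poly_opX poly_opC ipBl ipZl ipxx => h.
have : nrm x ^+ 2 <= 0 by have := hM x; lra.
have := sqr_ge0 (nrm x) => h1 h2.
have -> : nrm x ^+ 2 = 0 by apply/eqP; rewrite eq_le h1 h2.
by rewrite mulr0.
Qed.

(** Positivity of e^2 - q(T)^2, which bounds |q(T) x| directly. *)
Lemma poly_op_norm_le q T e : self_adjoint T -> 0 <= e ->
  (forall t : R, spectrum T t%:C -> `|q.[t]| <= e) ->
  forall x, nrm (poly_op q T x) <= e * nrm x.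
Proof.
move=> aT e0 qT x; have lT := aT.1.1.
have /self_adjointP[_ sq] := poly_op_self_adjoint q aT.
have := @poly_op_ge0 ((e ^+ 2)%:P - q * q) T aT.
have h t : spectrum T t%:C -> 0 <= ((e ^+ 2)%:P - q * q).[t].
  move=> /qT; rewrite !hornerE ler_norml => /andP[*]; nra.
move=> /(_ h x); rewrite poly_opB// poly_opC poly_opM// ipBl ipZl sq !ipxx.
move=> le2; rewrite -(ler_pXn2r (ltn0Sn 1)) ?nnegrE ?(mulr_ge0 e0) ?nrm_ge0//.
by rewrite exprMn -subr_ge0.
Qed.

End calculus.

(** * Functional calculus *)

Section funcalc.
Context {R : realType} {H : hilbertType R}.
Implicit Types (x y : H) (S T : H -> H) (p q : {poly R}) (e : R) (f g : R -> R).

Lemma le0_of_le_eps (u k : R) : (forall e, 0 < e -> u <= e * k) -> u <= 0.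
Proof.
move=> h; have k0 : 0 < `|k| + 1 by rewrite ltr_wpDl.
apply/ler_addgt0Pl => e e0; rewrite addr0.
apply: (le_trans (h (e / (`|k| + 1)) (divr_gt0 e0 k0))).
rewrite mulrAC ler_pdivrMr// ler_wpM2l ?(ltW e0)//.
by have := ler_norm k; lra.
Qed.

Lemma is_fun_calcP f T S : is_fun_calc f T S <->
  forall e, 0 < e -> exists p,
    (forall t : R, spectrum T t%:C -> `|p.[t] - f t| <= e) /\
    (forall x, nrm (poly_op p T x - S x) <= e * nrm x).
Proof.
by split=> h e /h[p [p1 p2]]; exists p; split=> // x;
  move: (p2 x); rewrite !nrmE -rmorphM lecR.
Qed.

Lemma nrm_triangle x y (z : H) : nrm (x - z) <= nrm (x - y) + nrm (y - z).
Proof. by rewrite -{1}(subrK y x) -addrA nrmD. Qed.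

(** Linearity, boundedness and symmetry pass to limits in operator norm; each is
    an identity or inequality up to a multiple of an arbitrary e. *)
Lemma fun_calc_self_adjoint f T S : self_adjoint T -> is_fun_calc f T S ->
  self_adjoint S.
Proof.
move=> aT /is_fun_calcP hS; have lT := aT.1.1.
apply/self_adjointP; split; first apply/bounded_opP; first split.
- move=> k x y; apply/eqP; rewrite -subr_eq0; apply/eqP/nrm0_eq0/eqP.
  rewrite eq_le nrm_ge0 andbT.
  apply: (@le0_of_le_eps _ (nrm (k *: x + y) + (complex.Re `|k| * nrm x + nrm y))).
  move=> e /hS[p [_ hp]]; have lp := poly_op_linear p lT.
  apply: (le_trans (nrm_triangle _ (poly_op p T (k *: x + y)) _)).
  rewrite mulrDr lerD//; first by rewrite nrmB.
  rewrite lp opprD addrACA -scalerBr (le_trans (nrmD _ _))// mulrDr lerD//.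
  rewrite nrmZc mulrCA ler_wpM2l//.
  by rewrite -lecR RRe_real ?normr_real ?normr_ge0.
- have [p [_ hp]] := hS 1 ltr01.
  have /bounded_opP[_ [M [M0 hM]]] := (poly_op_self_adjoint p aT).1.
  exists (1 + M); split; first by rewrite addr_gt0.
  move=> x; rewrite -[S x]subr0.
  apply: (le_trans (nrm_triangle _ (poly_op p T x) _)).
  by rewrite mulrDl lerD// ?subr0// nrmB.
- move=> x y; apply/eqP; rewrite -subr_eq0 -normr_le0.
  apply: (@le0_of_le_eps _ (2 * (nrm x * nrm y))) => e /hS[p [_ hp]].
  have /self_adjointP[_ sp] := poly_op_self_adjoint p aT.
  have b1 (u w : H) : `|ip u w| <= nrm u * nrm w.
    rewrite ler_norml ip_le andbT lerNl -ipNl -(nrmN u); exact: ip_le.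
  have -> : ip (S x) y - ip x (S y) =
    ip x (poly_op p T y - S y) - ip (poly_op p T x - S x) y.
    by rewrite ipBl ipBr sp; ring.
  rewrite (le_trans (ler_normB _ _))//.
  have := le_trans (b1 _ _) (ler_wpM2l (nrm_ge0 x) (hp y)).
  have := le_trans (b1 _ _) (ler_wpM2r (nrm_ge0 y) (hp x)).
  lra.
Qed.

Lemma fun_calc_add f g T S S' : is_fun_calc f T S -> is_fun_calc g T S' ->
  is_fun_calc (fun t => f t + g t) T (S + S').
Proof.
move=> /is_fun_calcP hf /is_fun_calcP hg; apply/is_fun_calcP => e e0.
have e2 : 0 < e / 2 by rewrite divr_gt0.
have [p [p1 p2]] := hf _ e2; have [q [q1 q2]] := hg _ e2.
have eE : e = e / 2 + e / 2 by lra.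
exists (p + q); split.
  move=> t st; rewrite hornerD opprD addrACA eE.
  by rewrite (le_trans (ler_normD _ _))// lerD ?p1 ?q1.
move=> x; rewrite poly_opD addrfctE opprD addrACA eE mulrDl.
by rewrite (le_trans (nrmD _ _))// lerD ?p2 ?q2.
Qed.

Lemma fun_calc_scale (k : R) f T S : linear T -> is_fun_calc f T S ->
  is_fun_calc (fun t => k * f t) T (k%:C *: S).
Proof.
move=> lT /is_fun_calcP hf; apply/is_fun_calcP => e e0.
have k0 : 0 < `|k| + 1 by rewrite ltr_wpDl.
have [p [p1 p2]] := hf _ (divr_gt0 e0 k0).
have ke : `|k| * (e / (`|k| + 1)) <= e.
  by rewrite mulrCA ger_pMr// ler_pdivrMr//; lra.
exists (k *: p); split.
  move=> t st; rewrite hornerZ -mulrBr normrM (le_trans _ ke)//.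
  by rewrite ler_wpM2l// p1.
move=> x; rewrite poly_opZ// scalrfctE -scalerBr nrmZ.
apply: (le_trans (ler_wpM2l (normr_ge0 k) (p2 x))).
by rewrite mulrA ler_wpM2r// nrm_ge0.
Qed.

(** The bounds on f and g control the error of the product of approximating
    polynomials on the spectrum. *)
Lemma fun_calc_mul f g T S S' F G : self_adjoint T ->
  (forall t : R, spectrum T t%:C -> `|f t| <= F) ->
  (forall t : R, spectrum T t%:C -> `|g t| <= G) ->
  is_fun_calc f T S -> is_fun_calc g T S' ->
  is_fun_calc (fun t => f t * g t) T (S \o S').
Proof.
move=> aT hF hG cf cg; have lT := aT.1.1.
have /bounded_opP[lS [M [M0 hM]]] := (fun_calc_self_adjoint aT cf).1.
have /bounded_opP[_ [N [N0 hN]]] := (fun_calc_self_adjoint aT cg).1.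
move: cf cg => /is_fun_calcP hf /is_fun_calcP hg; apply/is_fun_calcP => e e0.
pose K := M + N + `|F| + `|G| + 1.
have K0 : 0 < K by rewrite ltr_wpDl// !addr_ge0// ltW.
pose d := Num.min 1 (e / K).
have d0 : 0 < d by rewrite lt_min ltr01 divr_gt0.
have d1 : d <= 1 by rewrite ge_min lexx.
have dK : d * K <= e by rewrite -ler_pdivlMr// ge_min lexx orbT.
have dM : 0 <= d * M by rewrite mulr_ge0// ltW.
have dN : 0 <= d * N by rewrite mulr_ge0// ltW.
have dF : 0 <= d * `|F| by rewrite mulr_ge0// ltW.
have dG : 0 <= d * `|G| by rewrite mulr_ge0// ltW.
have [p [p1 p2]] := hf _ d0; have [q [q1 q2]] := hg _ d0.
exists (p * q); split.
  move=> t st; rewrite hornerM.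
  have -> : p.[t] * q.[t] - f t * g t =
    (p.[t] - f t) * (q.[t] - g t) + (p.[t] - f t) * g t + f t * (q.[t] - g t).
    by ring.
  apply: (le_trans (ler_normD _ _)).
  apply: (le_trans (lerD (ler_normD _ _) (lexx _))); rewrite !normrM.
  have h1 : `|p.[t] - f t| * `|q.[t] - g t| <= d * 1.
    by rewrite ler_pM ?p1// (le_trans (q1 _ st)).
  have h2 : `|p.[t] - f t| * `|g t| <= d * `|G|.
    by rewrite ler_pM ?p1// (le_trans (hG _ st))// ler_norm.
  have h3 : `|f t| * `|q.[t] - g t| <= `|F| * d.
    by rewrite ler_pM ?q1// (le_trans (hF _ st))// ler_norm.
  by move: dK; rewrite /K; lra.
move=> x; rewrite poly_opM//=.
apply: (le_trans (nrm_triangle _ (S (poly_op q T x)) _)).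
have h1 := le_trans (hM _) (ler_wpM2l (ltW M0) (q2 x)).
rewrite (linB lS) in h1.
have h2 : nrm (poly_op q T x) <= (d + N) * nrm x.
  rewrite -[poly_op q T x]subr0 (le_trans (nrm_triangle _ (S' x) _))//.
  by rewrite subr0 mulrDl lerD ?q2 ?hN.
have h3 := le_trans (p2 (poly_op q T x)) (ler_wpM2l (ltW d0) h2).
have x0 := nrm_ge0 x.
have := ler_wpM2r x0 dK.
have := ler_wpM2r x0 (ler_wpM2l (ltW d0) d1).
have := mulr_ge0 dF x0; have := mulr_ge0 dG x0.
by rewrite /K; lra.
Qed.

Lemma fun_calc_id T : is_fun_calc id T T.
Proof.
apply/is_fun_calcP => e e0; exists 'X; split=> [t _|x].
  by rewrite hornerX subrr normr0 ltW.
by rewrite poly_opX subrr nrm0 mulr_ge0 ?nrm_ge0 ?ltW.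
Qed.

Lemma fun_calc_1 T : is_fun_calc (fun=> 1) T id.
Proof.
apply/is_fun_calcP => e e0; exists 1; split=> [t _|x].
  by rewrite hornerC subrr normr0 ltW.
by rewrite -polyC1 poly_opC scale1r subrr nrm0 mulr_ge0 ?nrm_ge0 ?ltW.
Qed.

Lemma fun_calc_ge0 f T S : self_adjoint T -> is_fun_calc f T S ->
  (forall t : R, spectrum T t%:C -> 0 <= f t) -> positive_op S.
Proof.
move=> aT cf f0; apply/positive_opP; split; first exact: fun_calc_self_adjoint cf.
move=> x; rewrite -oppr_le0; apply: (@le0_of_le_eps _ (2 * nrm x ^+ 2)) => e e0.
have lT := aT.1.1; have /is_fun_calcP/(_ e e0)[p [p1 p2]] := cf.
have := @poly_op_ge0 _ _ (p + e%:P) T aT.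
have h t : spectrum T t%:C -> 0 <= (p + e%:P).[t].
  move=> st; have := p1 t st; have := f0 t st.
  by rewrite hornerD hornerC ler_norml => ? /andP[*]; lra.
move=> /(_ h x); rewrite poly_opD poly_opC ipDl ipZl ipxx.
have := ip_le (poly_op p T x - S x) x; rewrite ipBl.
by have := ler_wpM2r (nrm_ge0 x) (p2 x); lra.
Qed.

Lemma fun_calc_unique f g T S S' : self_adjoint T ->
  is_fun_calc f T S -> is_fun_calc g T S' ->
  (forall t : R, spectrum T t%:C -> f t = g t) -> S = S'.
Proof.
move=> aT /is_fun_calcP hf /is_fun_calcP hg fg; apply/funext => x.
have lT := aT.1.1.
apply/eqP; rewrite -subr_eq0; apply/eqP/nrm0_eq0/eqP; rewrite eq_le nrm_ge0 andbT.
apply: (@le0_of_le_eps _ (4 * nrm x)) => e e0.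
have [p [p1 p2]] := hf _ e0; have [q [q1 q2]] := hg _ e0.
have e2 : 0 <= 2 * e by lra.
have h t : spectrum T t%:C -> `|(p - q).[t]| <= 2 * e.
  move=> st; have := p1 t st; have := q1 t st; rewrite (fg t st) hornerD hornerN.
  by rewrite !ler_norml => /andP[? ?] /andP[? ?]; apply/andP; split; lra.
have := poly_op_norm_le aT e2 h x; rewrite poly_opB// => h1.
have h2 := p2 x; have h3 := q2 x; rewrite nrmB in h2.
have := nrm_triangle (S x) (poly_op p T x) (S' x).
have := nrm_triangle (poly_op p T x) (poly_op q T x) (S' x).
lra.
Qed.

(** By [poly_op_norm_le] polynomials converging uniformly on the spectrum give a
    sequence of operators that is Cauchy in norm; its pointwise limit is f(T). *)
Lemma fun_calc_exists f T : self_adjoint T ->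
  (forall e, 0 < e -> exists p,
     forall t : R, spectrum T t%:C -> `|p.[t] - f t| <= e) ->
  is_fun_calc f T (fun_calc f T).
Proof.
move=> aT hf; have lT := aT.1.1.
suff [S cS] : exists S, is_fun_calc f T S by exact: (xgetPex _ (ex_intro _ S cS)).
have [i [iS inv_le small]] : exists i : nat -> R, [/\ forall n, 0 < i n,
    forall m n, (n <= m)%N -> i m <= i n &
    forall e k, 0 < e -> 0 <= k -> exists n, i n * k <= e].
  exists (fun n => n.+1%:R^-1); split=> [n|m n nm|e k e0 k0].
  - by rewrite invr_gt0.
  - by rewrite lef_pV2 ?posrE// ler_nat.
  - exists (Num.bound (k / e)).
    rewrite mulrC ler_pdivrMr// mulrC -ler_pdivrMr// ltW//.
    by rewrite (lt_le_trans (archi_boundP (divr_ge0 k0 (ltW e0))))// ler_nat.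
have /choice[p hp] : forall n, exists p, forall t : R, spectrum T t%:C ->
    `|p.[t] - f t| <= i n by move=> n; exact: hf.
have pd n m x : (n <= m)%N ->
    nrm (poly_op (p n) T x - poly_op (p m) T x) <= 2 * i n * nrm x.
  move=> nm; rewrite -poly_opB//; apply: poly_op_norm_le => //.
    by rewrite mulr_ge0// ltW.
  move=> t st; have := hp n t st; have := le_trans (hp m t st) (inv_le _ _ nm).
  rewrite hornerD hornerN !ler_norml => /andP[? ?] /andP[? ?].
  by apply/andP; split; lra.
have /choice[S hS] : forall x, exists l, forall e, 0 < e -> exists N,
    forall n, (N <= n)%N -> nrm (poly_op (p n) T x - l) <= e.
  move=> x; apply: nrm_complete => e e0.
  have [|N hN] := small e (4 * nrm x) e0; first by rewrite mulr_ge0 ?nrm_ge0.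
  exists N => m n Nm Nn.
  have := nrm_triangle (poly_op (p m) T x) (poly_op (p N) T x) (poly_op (p n) T x).
  have := pd _ _ x Nm; have := pd _ _ x Nn; rewrite [in X in _ -> X -> _]nrmB.
  by lra.
exists S; apply/is_fun_calcP => e e0.
have [|n hn] := small e 2 e0 => //.
exists (p n); split=> [t st|x].
  by apply: (le_trans (hp n t st)); have := iS n; lra.
apply/ler_addgt0Pl => d d0.
have [N hN] := hS x d d0; have := hN (maxn N n) (leq_maxl _ _).
have := pd n (maxn N n) x (leq_maxr _ _).
have := nrm_triangle (poly_op (p n) T x) (poly_op (p (maxn N n)) T x) (S x).
by have := ler_wpM2r (nrm_ge0 x) hn; lra.
Qed.

End funcalc.

(** * Powers of positive invertible operators and Heinz means *)

Section powers.
Context {R : realType} {H : hilbertType R}.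
Implicit Types (x y : H) (S T A B : H -> H) (a b c u v w : R).

Lemma positive_invertibleP T : positive_invertible T <->
  self_adjoint T /\ exists c, 0 < c /\ forall x, c * nrm x ^+ 2 <= ip (T x) x.
Proof.
split=> [[/positive_opP[aT T0] iT]|[aT [c [c0 hc]]]].
  by split=> //; exact: positive_coercive.
split; last exact: coercive_invertible hc.
apply/positive_opP; split=> // x; apply: le_trans (hc x).
by rewrite mulr_ge0 ?sqr_ge0 ?ltW.
Qed.

Lemma spectrum_ge T c : self_adjoint T ->
  (forall x, c * nrm x ^+ 2 <= ip (T x) x) ->
  forall t : R, spectrum T t%:C -> c <= t.
Proof.
move=> aT hc t st; rewrite leNgt; apply/negP => tc; apply: st.
have aS : self_adjoint (T - t%:C *: id).
  by apply: self_adjoint_sub => //; exact/self_adjoint_scale/self_adjoint_id.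
apply: (coercive_invertible aS (c := c - t)); first by rewrite subr_gt0.
move=> x; rewrite -[(_ - _) x]/(T x - t%:C *: x) ipBl ipZl ipxx.
by have := hc x; lra.
Qed.

Lemma spectrum_le T c : self_adjoint T ->
  (forall x, ip (T x) x <= c * nrm x ^+ 2) ->
  forall t : R, spectrum T t%:C -> t <= c.
Proof.
move=> aT hc t st; rewrite leNgt; apply/negP => tc; apply: st.
have aS : self_adjoint (t%:C *: id - T).
  by apply: self_adjoint_sub => //; exact/self_adjoint_scale/self_adjoint_id.
have -> : (fun x => T x - t%:C *: x) =
    (fun x => (-1) *: x) \o (t%:C *: id - T).
  by apply/funext => x; rewrite /comp scaleN1r -[(_ - _) x]/(t%:C *: x - T x) opprB.
apply: invertible_comp; first by apply: invertible_scale; rewrite oppr_eq0 oner_neq0.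
apply: (coercive_invertible aS (c := t - c)); first by rewrite subr_gt0.
move=> x; rewrite -[(_ - _) x]/(t%:C *: x - T x) ipBl ipZl ipxx.
by have := hc x; lra.
Qed.

Lemma positive_invertible_spectrum T : positive_invertible T ->
  exists c M, [/\ 0 < c, c < M &
    forall t : R, spectrum T t%:C -> c <= t <= M].
Proof.
move=> /positive_invertibleP[aT [c [c0 hc]]].
have [M [M0 hM]] := form_bounded aT.1.
exists c, (M + c); split=> //; first by rewrite ltrDr.
move=> t st; rewrite (spectrum_ge aT hc st)/=.
by have := spectrum_le aT hM st; lra.
Qed.

(** The spectrum lies in a compact interval of ]0, +oo[, where every real power
    is Lipschitz. *)
Lemma op_powRP T v : positive_invertible T ->
  is_fun_calc (fun t => t `^ v) T (op_powR T v).
Proof.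
move=> pT; have [c [M [c0 cM hs]]] := positive_invertible_spectrum pT.
apply: fun_calc_exists; first exact: pT.1.1.
move=> e e0; have [p hp] := weierstrass_lipschitz cM
  (fun s t => @powR_lipschitz R c M v s t c0) e0.
by exists p => t st; apply: hp; exact: hs.
Qed.

Lemma spectrum_gt0 T (t : R) : positive_invertible T -> spectrum T t%:C -> 0 < t.
Proof.
move=> /positive_invertible_spectrum[c [M [c0 _ hs]]] /hs/andP[ct _].
exact: lt_le_trans ct.
Qed.

Lemma op_powR_self_adjoint T v : positive_invertible T -> self_adjoint (op_powR T v).
Proof. by move=> pT; apply: fun_calc_self_adjoint (op_powRP v pT); exact: pT.1.1. Qed.

Lemma op_powR_bound T v : positive_invertible T ->
  exists F, forall t : R, spectrum T t%:C -> `|t `^ v| <= F.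
Proof.
move=> /positive_invertible_spectrum[c [M [c0 _ hs]]].
exists (c `^ v + M `^ v) => t /hs h; rewrite ger0_norm ?powR_ge0//.
exact: powR_le_endpoints.
Qed.

Lemma op_powRD T v w : positive_invertible T ->
  op_powR T v \o op_powR T w = op_powR T (v + w).
Proof.
move=> pT; have aT : self_adjoint T := pT.1.1.
have [F hF] := op_powR_bound v pT; have [G hG] := op_powR_bound w pT.
apply: (fun_calc_unique aT (fun_calc_mul aT hF hG (op_powRP v pT) (op_powRP w pT))
  (op_powRP (v + w) pT)).
move=> t /(spectrum_gt0 pT) t0.
by rewrite powRD// (gt_eqF t0) implybT.
Qed.

Lemma op_powR0 T : positive_invertible T -> op_powR T 0 = id.
Proof.
move=> pT; apply: (fun_calc_unique pT.1.1 (op_powRP 0 pT) (fun_calc_1 T)).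
by move=> t _; rewrite powRr0.
Qed.

Lemma op_powR1 T : positive_invertible T -> op_powR T 1 = T.
Proof.
move=> pT; apply: (fun_calc_unique pT.1.1 (op_powRP 1 pT) (fun_calc_id T)).
by move=> t /(spectrum_gt0 pT)/ltW t0; rewrite powRr1.
Qed.

Lemma positive_invertible_congr A S S' : positive_invertible A -> self_adjoint S ->
  bounded_op S' -> cancel S S' -> cancel S' S -> positive_invertible (S \o A \o S).
Proof.
move=> [/positive_opP[aA A0] iA] aS bS' SS' S'S.
have iS : invertible_op S by split; [exact: aS.1|exists S'; split].
split; last by apply: invertible_comp => //; exact: invertible_comp.
apply/positive_opP; split; first exact: self_adjoint_conj.
by have /self_adjointP[_ sS] := aS; move=> x /=; rewrite sS.
Qed.

(** With D k = Z k - G the k-th term is 2^(k-2) D (k-1) - 2^(k-1) D k. The sequences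
    X and Y allow the two occurrences of Z to be written with different
    expressions of the parameter. *)
Lemma sum_telescope (V : lmodType R[i]) (X Y Z : nat -> V) (G : V) n :
  (forall k, (1 < k)%N -> X k = Z k) -> (forall k, (1 < k)%N -> Y k = Z (k - 1)%N) ->
  \sum_(2 <= k < n.+2) 2 ^+ (k - 2) *: (G - 2 *: X k + Y k) =
  (Z 1%N - G) - 2 ^+ n *: (Z n.+1 - G).
Proof.
move=> XZ YZ; elim: n => [|n IH]; first by rewrite big_geq// expr0 scale1r subrr.
rewrite big_nat_recr//= IH XZ// YZ// !subSS !subn0 -addrA; congr (_ + _).
rewrite addrC -scalerBr exprSr -scalerA -[RHS]scalerN; congr (_ *: _).
rewrite opprB [G - Z n.+1]addrC addrA addrK -[RHS]scalerN opprB scalerBr.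
by rewrite addrAC (scaler_nat 2 G) mulr2n.
Qed.

Section mean.
Variables (A B : H -> H).
Hypotheses (pA : positive_invertible A) (pB : positive_invertible B).

Let P := op_powR A 2^-1.
Let Q := op_powR A (- 2^-1).
Let C := Q \o B \o Q.

Lemma half_powR_sqr : P \o P = A.
Proof.
rewrite op_powRD// (_ : 2^-1 + 2^-1 = 1) ?op_powR1//; lra.
Qed.

Lemma half_powRK : P \o Q = id.
Proof. by rewrite op_powRD// subrr op_powR0. Qed.

Lemma half_powRVK : Q \o P = id.
Proof. by rewrite op_powRD// addNr op_powR0. Qed.

Lemma conj_positive_invertible : positive_invertible C.
Proof.
apply: (@positive_invertible_congr _ _ P) => //.
- exact: op_powR_self_adjoint.
- by have [] := op_powR_self_adjoint 2^-1 pA.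
- by move=> x; rewrite -[LHS]/((P \o Q) x) half_powRK.
- by move=> x; rewrite -[LHS]/((Q \o P) x) half_powRVK.
Qed.

(** The Heinz mean of the identity and C. *)
Definition heinz_op w : H -> H := 2^-1%:C *: (op_powR C w + op_powR C (1 - w)).

Lemma heinz_opP w : is_fun_calc (heinz_fun w) C (heinz_op w).
Proof.
have pC := conj_positive_invertible; have lC : linear C := pC.1.1.1.1.
have := fun_calc_scale 2^-1 lC (fun_calc_add (op_powRP w pC) (op_powRP (1 - w) pC)).
by congr is_fun_calc; apply/funext => t; rewrite /heinz_fun mulrC.
Qed.

Lemma heinz_meanE w : heinz_mean w A B = P \o heinz_op w \o P.
Proof.
apply/funext => x; have lP : linear P := (op_powR_self_adjoint 2^-1 pA).1.1.
rewrite /heinz_mean /heinz_op /= !scalrfctE !addrfctE /nat_mean/=.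
by rewrite (linZ lP) (linD lP) fmorphV rmorph_nat.
Qed.

Lemma heinz_mean_half : heinz_mean 2^-1 A B = geom_mean A B.
Proof.
rewrite /heinz_mean (_ : 1 - 2^-1 = 2^-1); last lra.
apply/funext => x; rewrite scalrfctE addrfctE -mulr2n.
rewrite -(@scaler_nat _ _ 2 (nat_mean 2^-1 A B x)) scalerA.
by rewrite mulVf ?scale1r// pnatr_eq0.
Qed.

(** For w = 1 the two summands are P C P = B and P P = A. *)
Lemma heinz_mean1 : heinz_mean 1 A B = arith_mean A B.
Proof.
have pC := conj_positive_invertible.
rewrite /heinz_mean /arith_mean subrr addrC; congr (_ *: (_ + _)).
  by rewrite /nat_mean op_powR0//; exact: half_powR_sqr.
apply/funext => x; rewrite /nat_mean op_powR1//.
have PQ y : P (Q y) = y by rewrite -[LHS]/((P \o Q) y) half_powRK.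
have QP y : Q (P y) = y by rewrite -[LHS]/((Q \o P) y) half_powRVK.
by rewrite /= -/P -/Q PQ QP.
Qed.

Lemma heinz_meanC w : heinz_mean (1 - w) A B = heinz_mean w A B.
Proof. by rewrite /heinz_mean opprB addrCA subrr addr0 addrC. Qed.

(** Conjugation by P preserves positivity, so the scalar secant inequality on the
    spectrum of C carries over to the Heinz means. *)
Lemma heinz_mean_secant a b v : a < b -> v < a \/ b < v ->
  positive_op (heinz_mean v A B - heinz_mean a A B
    - ((v - a) / (b - a))%:C *: (heinz_mean b A B - heinz_mean a A B)).
Proof.
move=> ab vab; have pC := conj_positive_invertible.
have aC : self_adjoint C := pC.1.1; have lC := aC.1.1.
have aP : self_adjoint P by exact: op_powR_self_adjoint.
have /self_adjointP[bP sP] := aP; have lP := bP.1.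
set k := _ / _.
pose D := heinz_op v - heinz_op a - k%:C *: (heinz_op b - heinz_op a).
have DE : is_fun_calc (fun t => heinz_fun v t - heinz_fun a t -
    k * (heinz_fun b t - heinz_fun a t)) C D.
  have sub f g (S T : H -> H) : is_fun_calc f C S -> is_fun_calc g C T ->
      is_fun_calc (fun t => f t - g t) C (S - T).
    move=> cf cg; have := fun_calc_add cf (fun_calc_scale (-1) lC cg).
    rewrite rmorphN1 scaleN1r; congr is_fun_calc.
    by apply/funext => t; rewrite mulN1r.
  by apply: (sub _ _ _ _ (sub _ _ _ _ _ _) (fun_calc_scale _ lC (sub _ _ _ _ _ _)));
    exact: heinz_opP.
have /positive_opP[aD D0] : positive_op D.
  apply: (fun_calc_ge0 aC DE) => t /(spectrum_gt0 pC) t0.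
  exact: heinz_secant.
rewrite !heinz_meanE.
have -> : (P \o heinz_op v \o P) - (P \o heinz_op a \o P) -
    k%:C *: ((P \o heinz_op b \o P) - (P \o heinz_op a \o P)) = P \o D \o P.
  apply/funext => x.
  rewrite -[RHS]/(P (heinz_op v (P x) - heinz_op a (P x) -
    k%:C *: (heinz_op b (P x) - heinz_op a (P x)))).
  by rewrite !(linB lP) (linZ lP k%:C (_ - _)) (linB lP).
apply/positive_opP; split; first exact: self_adjoint_conj.
by move=> x /=; rewrite sP.
Qed.


(** The first inequality with an arbitrary presentation of the parameters: s k
    and r k stand for expressions that yield the Heinz means at 1/2 + 2^(-k) and
    1/2 + 2^(-(k-1)), possibly through the symmetry w |-> 1 - w. *)
Lemma heinz_mean_telescope n v (s r : nat -> R) : (0 < n)%N ->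
  (forall k, (1 < k)%N ->
     heinz_mean (s k) A B = heinz_mean (2^-1 + (2 ^+ k)^-1) A B) ->
  (forall k, (1 < k)%N ->
     heinz_mean (r k) A B = heinz_mean (2^-1 + (2 ^+ (k - 1))^-1) A B) ->
  v < 2^-1 \/ 2^-1 + (2 ^+ n)^-1 < v ->
  loewner_le (arith_mean A B)
    (heinz_mean v A B
     + (2 * (1 - v))%:C *: (arith_mean A B - geom_mean A B)
     + (2 * v - 1)%:C *: \sum_(2 <= k < n.+1) 2 ^+ (k - 2) *:
         (geom_mean A B - 2 *: heinz_mean (s k) A B + heinz_mean (r k) A B)).
Proof.
case: n => // n _ sE rE hv; pose X k := heinz_mean (2^-1 + (2 ^+ k)^-1) A B.
rewrite /loewner_le (@sum_telescope _ (fun k => heinz_mean (s k) A B)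
  (fun k => heinz_mean (r k) A B) X _ _ sE rE).
have X1 : X 1%N = arith_mean A B.
  by rewrite -heinz_mean1 /X expr1 (_ : 2^-1 + 2^-1 = 1)//; lra.
have n0 : 0 < (2 ^+ n.+1)^-1 :> R by rewrite invr_gt0 exprn_gt0.
have := @heinz_mean_secant 2^-1 (2^-1 + (2 ^+ n.+1)^-1) v _ hv.
rewrite ltrDl n0 => /(_ isT); rewrite -/(X n.+1) X1 heinz_mean_half.
have -> : (v - 2^-1) / (2^-1 + (2 ^+ n.+1)^-1 - 2^-1) = (2 * v - 1) * 2 ^+ n :> R.
  by rewrite [2^-1 + _ - _]addrAC subrr add0r invrK exprS; field.
congr (positive_op _).
(* What remains is linear in the four operators. *)
move: (heinz_mean v A B) (geom_mean A B) (arith_mean A B) (X n.+1) => h G D Y.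
rewrite (scalerBr (2 * v - 1)%:C) (scalerA (2 * v - 1)%:C).
rewrite rmorphM rmorphXn rmorph_nat [in RHS]addrA.
rewrite -[X in _ = X - _ - D]addrA -scalerDl -rmorphD.
rewrite (_ : 2 * (1 - v) + (2 * v - 1) = 1); last by ring.
by rewrite scale1r [RHS]addrAC; congr (_ - _); rewrite [D - G]addrC addrA addrK.
Qed.

End mean.
End powers.

Unset Implicit Arguments.

Theorem corollary6 (R : realType) (H : hilbertType R) (A B : H -> H)
    (hA : positive_invertible A) (hB : positive_invertible B)
    (n : nat) (hn : (2 <= n)%N) (v : R) (hv : v <> 2^-1) :
  (v \notin `[2^-1, (2 ^+ (n - 1) + 1) / 2 ^+ n] ->
   loewner_le (arith_mean A B)
     (heinz_mean v A B
      + (2 * (1 - v))%:C *: (arith_mean A B - geom_mean A B)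
      + (2 * v - 1)%:C *: \sum_(2 <= k < n.+1) 2 ^+ (k - 2) *:
          (geom_mean A B
           - 2 *: heinz_mean ((2 ^+ (k - 1) + 1) / 2 ^+ k) A B
           + heinz_mean ((2 ^+ (k - 2) + 1) / 2 ^+ (k - 1)) A B)))
  /\
  (v \notin `[(2 ^+ (n - 1) - 1) / 2 ^+ n, 2^-1] ->
   loewner_le (arith_mean A B)
     (heinz_mean v A B
      + (2 * v)%:C *: (arith_mean A B - geom_mean A B)
      + (1 - 2 * v)%:C *: \sum_(2 <= k < n.+1) 2 ^+ (k - 2) *:
          (geom_mean A B
           - 2 *: heinz_mean ((2 ^+ (k - 1) - 1) / 2 ^+ k) A B
           + heinz_mean ((2 ^+ (k - 2) - 1) / 2 ^+ (k - 1)) A B))).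
Proof.
have vk k : (0 < k)%N -> ((2 ^+ (k - 1) + 1) / 2 ^+ k = 2^-1 + (2 ^+ k)^-1 :> R).
  case: k => // k _; rewrite subSS subn0 exprS.
  have : (2 : R) ^+ k != 0 by rewrite expf_neq0.
  by move=> h; field.
have vk' k : (0 < k)%N ->
    ((2 ^+ (k - 1) - 1) / 2 ^+ k = 1 - (2^-1 + (2 ^+ k)^-1) :> R).
  case: k => // k _; rewrite subSS subn0 exprS.
  have : (2 : R) ^+ k != 0 by rewrite expf_neq0.
  by move=> h; field.
have k0 k : (1 < k)%N -> (0 < k)%N by exact: ltnW.
have k1 k : (1 < k)%N -> (0 < k - 1)%N by rewrite subn_gt0.
split; rewrite in_itv/= negb_and -!ltNge => /orP hv'.
- apply: (heinz_mean_telescope hA hB (k0 _ hn)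
    (s := fun k => (2 ^+ (k - 1) + 1) / 2 ^+ k)
    (r := fun k => (2 ^+ (k - 2) + 1) / 2 ^+ (k - 1))).
  + by move=> k /k0 hk; rewrite vk.
  + by move=> k /k1 hk; rewrite -vk// -subnDA.
  + by rewrite -vk ?k0.
(* The reflection w |-> 1 - w turns this into the first inequality at 1 - v. *)
- have hv2 : 1 - v < 2^-1 \/ 2^-1 + (2 ^+ n)^-1 < 1 - v.
    by move: hv'; rewrite vk' ?k0//; case=> ?; [right|left]; lra.
  have := heinz_mean_telescope hA hB (k0 _ hn)
    (s := fun k => (2 ^+ (k - 1) - 1) / 2 ^+ k)
    (r := fun k => (2 ^+ (k - 2) - 1) / 2 ^+ (k - 1)) _ _ hv2.
  rewrite heinz_meanC (_ : 1 - (1 - v) = v); last by ring.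
  rewrite (_ : 2 * (1 - v) - 1 = 1 - 2 * v); last by ring.
  apply.
  + by move=> k /k0 hk; rewrite vk'// heinz_meanC.
  + by move=> k /k1 hk; rewrite -[RHS]heinz_meanC -vk'// -subnDA.
Qed.
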